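(* For every pair of positive integers $k,q$, with $p= n^{-1-(k(q+1))^{-2(k+1)}}$, with high probability Client has a strategy to win $CW(G_{n,p},T_{k,k},q)$; that is, the probability that Client has a winning strategy in this game tends to $1$ as $n\to\infty$.
   Context: Client-Waiter game on a board $X$ with bias $q$ (a positive integer): two players, Client and Waiter, play in turns. In each turn Waiter offers Client a set of at least $1$ and at most $q+1$ unclaimed elements of $X$; Client claims exactly one of the offered elements and Waiter claims all the other offered elements. The game ends when all elements of $X$ have been claimed. For graphs $G,H$, $CW(G,H,q)$ is the Client-Waiter game on the board $E(G)$ with bias $q$ in which Client wins if at the end of the game the graph formed by the edges he claimed contains a copy of $H$ (as a not necessarily induced subgraph), and otherwise Waiter wins. $T_{k,k}$ is the complete $k$-ary tree of height $k$ (a rooted tree in which every non-leaf vertex has exactly $k$ children and every leaf is at distance $k$ from the root). $G_{n,p}$ is the random graph on $n$ vertices in which each edge of $K_n$ is included independently with probability $p$. *)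

(* Defs.v *)
From mathcomp Require Import all_boot all_order all_algebra.
From mathcomp Require Import all_classical all_reals all_analysis.

Set Implicit Arguments.
Unset Strict Implicit.
Unset Printing Implicit Defensive.

Import Order.TTheory GRing.Theory Num.Theory.
Local Open Scope ring_scope.

(* A simple graph on the vertex type V is represented by its edge set, a set
   of two-element subsets of V, i.e., a subset of [complete_graph V]. *)
Definition complete_graph (V : finType) : {set {set V}} :=
  [set e : {set V} | #|e| == 2%N].

(* The vertices of H are all the elements of W, so a copy of H is given by an
   injection of the whole of W. *)
Definition contains_copy (V W : finType)
    (G : {set {set V}}) (H : {set {set W}}) : Prop :=
  exists f : W -> V,
    injective f /\ forall e : {set W}, e \in H -> f @: e \in G.

(* The vertices are the words of length at most h over a k-letter alphabet; the
   root is the empty word and the children of u are the words [rcons u i]. *)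
Definition karytree (k h : nat) : {set {set h.-bseq 'I_k}} :=
  [set e : {set h.-bseq 'I_k} |
    [exists u : h.-bseq 'I_k, exists v : h.-bseq 'I_k, exists i : 'I_k,
      (bseqval v == rcons (bseqval u) i) && (e == [set u; v])]].

Section ClientWaiter.
Variable X : finType.

(* The set offered by Waiter, and the element of it claimed by Client. *)
Definition round : Type := ({set X} * X)%type.

(* Histories list the most recent round first. *)
Definition history : Type := seq round.

Definition unclaimed (B : {set X}) (h : history) : {set X} :=
  B :\: \bigcup_(r <- h) r.1.

Definition client_claims (h : history) : {set X} := [set x in map snd h].

Definition strategy : Type := history -> {set X} -> X.

Definition valid_strategy (s : strategy) : Prop :=
  forall (h : history) (S : {set X}), S != finset.set0 -> s h S \in S.

(* The histories that can arise on the board B with bias q, against an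
   arbitrary Waiter, when Client follows s. *)
Inductive played (B : {set X}) (q : nat) (s : strategy) : history -> Prop :=
| played_start : played B q s [::]
| played_round (h : history) (S : {set X}) :
    played B q s h ->
    S \subset unclaimed B h -> (1 <= #|S| <= q.+1)%N ->
    played B q s ((S, s h S) :: h).

Definition winning_strategy (B : {set X}) (q : nat) (win : {set X} -> Prop)
    (s : strategy) : Prop :=
  valid_strategy s /\
  forall h : history, played B q s h -> unclaimed B h = finset.set0 ->
    win (client_claims h).

Definition client_wins (B : {set X}) (q : nat) (win : {set X} -> Prop) : Prop :=
  exists s : strategy, winning_strategy B q win s.

End ClientWaiter.

Definition client_wins_CW (V W : finType)
    (G : {set {set V}}) (H : {set {set W}}) (q : nat) : Prop :=
  client_wins G q (fun C => contains_copy C H).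

(* The probability that the binomial random graph on 'I_n with edge
   probability p satisfies A. *)
Definition Gnp_prob (R : realType) (n : nat) (p : R)
    (A : {set {set 'I_n}} -> Prop) : R :=
  \sum_(G : {set {set 'I_n}} | (G \subset complete_graph 'I_n) && `[< A G >])
    \prod_(e in complete_graph 'I_n) (if e \in G then p else 1 - p).

(* Main.v *)
(** Put [N = k (q + 1)] and [D = N ^ 2].

    Game: Client wins on any board containing the complete [D]-ary tree of
    height [k]. He only has to claim [k] edges from every inner vertex to its
    children, i.e. to hit every set of [D - k + 1] such edges with a common
    parent. If each remaining edge were claimed with probability [1 / (q + 1)],
    the expected number of missed sets would be less than [1]; choosing each
    time the edge that minimises this expectation never increases it, whatever
    Waiter offers.

    Random graph: the [D]-ary tree has [v <= N ^ (2 (k + 1))] vertices, so the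
    expected number of its copies is of order [n ^ (1 - (v - 1) a)] with
    [a = N ^ (- 2 (k + 1))], which tends to infinity. Only copies whose vertices
    lie in prescribed disjoint parts of size [m = n %/ v] are counted. Two such
    copies agreeing on a nonempty set [J] of tree vertices share at most
    [#|J| - 1] edges, and since [m p <= 1] every [J] contributes at most one mean
    [mu] to the second moment, so that Chebyshev's inequality bounds the
    probability of having no copy by [2 ^ v / mu]. *)

Require Import Defs.
From mathcomp Require Import all_boot all_order all_algebra.
From mathcomp Require Import all_classical all_reals all_analysis.
From mathcomp Require Import lra ring zify.
Import mathcomp.boot.finset.
Import Order.TTheory GRing.Theory Num.Theory.
Import numFieldNormedType.Exports.
Local Open Scope ring_scope.

Set Implicit Arguments.
Unset Strict Implicit.
Unset Printing Implicit Defensive.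

(** * Hitting a family of sets as Client *)

Lemma bernoulli_power (R : realFieldType) (a : R) (n : nat) :
  0 <= a <= 1 -> 1 - n%:R * a <= (1 - a) ^+ n.
Proof.
move=> a01; elim: n => [|n IH]; first by rewrite expr0; lra.
have n0 : 0 <= n%:R :> R by [].
rewrite exprS -natr1.
have := @ler_wpM2l _ (1 - a) _ _ _ IH.
by move/(_ ltac:(lra)); nra.
Qed.

Section Transversal.
Variables (R : realFieldType) (X I : finType) (P : pred I).
Variables (A : I -> {set X}) (B : {set X}) (q : nat).

Let r : R := q%:R / q.+1%:R.

(* The expected number of sets missed by Client if he were to claim every
   remaining element with probability [1 / (q + 1)]. *)
Definition danger (h : history X) : R :=
  \sum_(i | P i && [disjoint A i & client_claims h])
     r ^+ #|A i :&: unclaimed B h|.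

Let r_ge0 : 0 <= r. Proof. by rewrite /r divr_ge0. Qed.

Lemma unclaimed_cons (S : {set X}) (x : X) (h : history X) :
  unclaimed B ((S, x) :: h) = unclaimed B h :\: S.
Proof. by rewrite /unclaimed big_cons setDDl setUC. Qed.

Lemma client_claims_cons (S : {set X}) (x : X) (h : history X) :
  client_claims ((S, x) :: h) = x |: client_claims h.
Proof. by apply/setP => y; rewrite !inE. Qed.

Lemma disjointU1r (T : finType) (D C : {set T}) (x : T) :
  [disjoint D & x |: C] = (x \notin D) && [disjoint D & C].
Proof.
by rewrite ![[disjoint D & _]]disjoints_subset setCU subsetI -disjoints_subset
  disjoint_sym disjoints1.
Qed.

(** If [S] meets [A i] in [j] elements, then [A i] stays missed for [#|S| - j] of the choices, and
    its term loses [j] factors [r]. So [#|S| - j <= #|S| * r ^+ j] suffices. This follows from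
    Bernoulli's inequality for [r = 1 - 1 / (q + 1)] and from [#|S| <= q + 1]. *)
Lemma danger_average (h : history X) (S : {set X}) :
  S \subset unclaimed B h -> (1 <= #|S| <= q.+1)%N ->
  \sum_(x in S) danger ((S, x) :: h) <= #|S|%:R * danger h.
Proof.
move=> SU /andP[S0 Sq].
rewrite /danger mulr_sumr.
under eq_bigr => x _ do rewrite client_claims_cons unclaimed_cons.
under eq_bigr => x _ do under eq_bigl => i do rewrite disjointU1r andbCA.
rewrite (exchange_big_dep (fun i => P i && [disjoint A i & client_claims h])) /=;
  last by move=> x i _ /andP[].
apply: ler_sum => i Pi.
rewrite sumr_const.
set j := #|A i :&: S|; set u := #|A i :&: unclaimed B h|.
have ju : (j <= u)%N by rewrite subset_leq_card// setIS.
have -> : #|A i :&: (unclaimed B h :\: S)| = (u - j)%N.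
  rewrite setIDA cardsD /u /j -setIA.
  by rewrite (setIidPr SU).
have -> : #|[pred x in S | (x \notin A i) && (P i && [disjoint A i & client_claims h])]|
    = (#|S| - j)%N.
  rewrite /j setIC -cardsD; apply: eq_card => x; rewrite !inE Pi.
  by rewrite andbT andbC.
have jS : (j <= #|S|)%N by rewrite subset_leq_card// subsetIr.
have -> : r ^+ u = r ^+ (u - j) * r ^+ j by rewrite -exprD subnK.
rewrite -[_ *+ (_ - j)]mulr_natr [leRHS]mulrCA ler_wpM2l ?exprn_ge0//.
rewrite natrB//.
have s0 : 0 < #|S|%:R :> R by rewrite ltr0n.
have rE : r = 1 - q.+1%:R^-1.
  by rewrite /r -[q%:R](addrK 1) natr1 mulrBl divff// mul1r.
have q1 : q.+1%:R * q.+1%:R^-1 = 1 :> R by rewrite divff.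
have b := @bernoulli_power R q.+1%:R^-1 j.
rewrite -rE in b.
apply: (@le_trans _ _ (#|S|%:R * (1 - j%:R * q.+1%:R^-1))).
  have qinv : #|S|%:R * q.+1%:R^-1 <= 1 :> R.
    by rewrite ler_pdivrMr// mul1r ler_nat.
  by rewrite mulrBr mulr1 lerD2l lerN2 mulrCA -[leRHS]mulr1 ler_wpM2l.
rewrite ler_wpM2l//; apply: b.
by rewrite invr_ge0 ler0n invf_le1// ler1n.
Qed.

(** The minimum needs a member of [S] to start from; [x0] only stands in when the offer is empty, a
    case on which [valid_strategy] imposes nothing. *)
Definition potential_strategy (x0 : X) : strategy X := fun h S =>
  [arg min_(x < odflt x0 [pick y in S] in S) danger ((S, x) :: h)]%O.

Lemma potential_strategyP (x0 : X) (h : history X) (S : {set X}) :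
  S != set0 ->
  potential_strategy x0 h S \in S /\
  forall y, y \in S ->
    danger ((S, potential_strategy x0 h S) :: h) <= danger ((S, y) :: h).
Proof.
move=> S0; rewrite /potential_strategy; case: arg_minP => [|x xS xmin].
  by case: pickP => //= S0'; case/set0Pn: S0 => x; rewrite S0'.
by split.
Qed.

Lemma danger_nonincreasing (x0 : X) (h : history X) :
  played B q (potential_strategy x0) h -> danger h <= danger [::].
Proof.
elim=> // {}h S ph IH SU cS; apply: le_trans IH.
have /andP[S0 _] := cS.
have [_ smin] := @potential_strategyP x0 h S ltac:(by rewrite -card_gt0).
have s0 : 0 < #|S|%:R :> R by rewrite ltr0n.
rewrite -(ler_pM2l s0); apply: (le_trans _ (danger_average SU cS)).
by rewrite mulr_natl -sumr_const; apply: ler_sum => y /smin.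
Qed.

Theorem client_wins_transversal (x0 : X) :
  (forall i, P i -> A i \subset B) ->
  \sum_(i | P i) r ^+ #|A i| < 1 ->
  client_wins B q (fun C => forall i, P i -> ~~ [disjoint A i & C]).
Proof.
move=> AB sum1; exists (potential_strategy x0); split=> [h S|h ph U0 i Pi].
  by case/(potential_strategyP x0 h).
apply/negP => dis.
have := danger_nonincreasing ph; rewrite leNgt => /negP; apply.
apply: (@lt_le_trans _ _ 1).
  apply: le_lt_trans sum1.
  rewrite /danger (eq_bigl P) => [|j]; last first.
    by rewrite disjoints_subset (_ : client_claims [::] = set0) ?setC0 ?subsetT ?andbT//;
      apply/setP => x; rewrite !inE.
  apply: ler_sum => j Pj; rewrite /unclaimed big_nil setD0.
  by rewrite (setIidPl (AB _ Pj)).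
(* Once nothing is unclaimed, a missed [A i] contributes [r ^+ 0 = 1] on its own. *)
rewrite /danger (bigD1 i) ?Pi//= U0 setI0 cards0 expr0 lerDl.
by apply: sumr_ge0 => j _; apply: exprn_ge0.
Qed.

End Transversal.

Lemma client_wins_mono (X : finType) (B : {set X}) (q : nat)
    (win win' : {set X} -> Prop) :
  (forall C, win C -> win' C) -> client_wins B q win -> client_wins B q win'.
Proof.
by move=> ww [s [vs ws]]; exists s; split=> // h ph U0; apply/ww/ws.
Qed.

(** * From claimed degrees to a tree *)

(** The tree is embedded from the root downwards: at each inner vertex an injection [c u] selects
    [k] available children, and [g] translates a word over ['I_k] letter by letter along these
    choices. *)
Lemma contains_copy_in_kary (V : finType) (C : {set {set V}}) (D k h : nat)
    (phi : seq 'I_D -> V) :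
  (0 < D)%N ->
  {in [pred s | (size s <= h)%N] &, injective phi} ->
  (forall u : seq 'I_D, (size u < h)%N ->
     (k <= #|[set i | [set phi u; phi (rcons u i)] \in C]|)%N) ->
  contains_copy C (karytree k h).
Proof.
move=> D_gt0 phi_inj deg.
have /choice[c cP] : forall u : seq 'I_D, exists c : 'I_k -> 'I_D,
    (size u < h)%N -> injective c /\
      forall i, [set phi u; phi (rcons u (c i))] \in C.
  move=> u; have [uh|hu] := ltnP (size u) h; last by exists (fun=> Ordinal D_gt0).
  have kS := deg _ uh.
  exists (fun i => enum_val (widen_ord kS i)) => _; split=> [i j /enum_val_inj|i].
    by move=> /(congr1 val) /= ij; apply: val_inj.
  by have := enum_valP (widen_ord kS i); rewrite inE.
pose g (w : seq 'I_k) : seq 'I_D := foldl (fun u i => rcons u (c u i)) [::] w.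
have g_rcons w i : g (rcons w i) = rcons (g w) (c (g w) i).
  by rewrite /g foldl_rcons.
have g_size w : size (g w) = size w.
  by elim/last_ind: w => // w i IH; rewrite g_rcons !size_rcons IH.
have g_inj w w' : (size w <= h)%N -> g w = g w' -> w = w'.
  elim/last_ind: w w' => [|w i IH] w' wh gw.
    by apply/esym/size0nil; rewrite -g_size -gw.
  case/lastP: w' gw => [/(congr1 size)|w' i']; first by rewrite g_rcons size_rcons.
  rewrite size_rcons in wh; rewrite !g_rcons => /rcons_inj[gw].
  rewrite -gw -(IH _ (ltnW wh) gw).
  by have [c_inj _] := cP (g w) ltac:(by rewrite g_size); move=> /c_inj ->.
exists (fun w : h.-bseq 'I_k => phi (g w)); split.
  move=> w w' /phi_inj gw; apply/val_inj/g_inj; first exact: size_bseq.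
  by apply: gw; rewrite inE g_size; exact: size_bseq.
move=> e; rewrite inE => /existsP[u /existsP[v /existsP[i /andP[/eqP vE /eqP ->]]]].
rewrite imsetU1 imset_set1 vE g_rcons.
have uh : (size u < h)%N by rewrite -(size_rcons _ i) -vE size_bseq.
by have [_] := cP (g u) ltac:(by rewrite g_size); apply.
Qed.

Lemma exists_subset_card (T : finType) (E : {set T}) (m : nat) :
  (m <= #|E|)%N -> exists2 B : {set T}, B \subset E & #|B| = m.
Proof.
rewrite -bin_gt0 -cards_draws => /card_gt0P[B]; rewrite inE => /andP[BE /eqP Bm].
by exists B.
Qed.

Lemma eq_set2r (T : finType) (x y z : T) : [set x; y] = [set x; z] -> y = z.
Proof.
move=> /setP E; have := E y; have := E z; rewrite !inE !eqxx !orbT.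
by have [->|_ /= /eqP//] := eqVneq z x; rewrite orbb => _ /esym/eqP.
Qed.

(* [k] claimed edges at every inner vertex amount to hitting every set of
   [D - k + 1] edges from an inner vertex to its children. *)
Lemma client_wins_kary (R : realFieldType) (V : finType) (G : {set {set V}})
    (D k h q : nat) :
  (0 < k <= D)%N -> (0 < h)%N -> contains_copy G (karytree D h) ->
  (\sum_(i < h) D ^ i * 'C(D, (D - k).+1))%:R
    * (q%:R / q.+1%:R) ^+ (D - k).+1 < 1 :> R ->
  client_wins_CW G (karytree k h) q.
Proof.
(* From here the height is [h.+1], so the inner vertices are exactly the words in [h.-bseq 'I_D]. *)
case: h => // h /andP[k0 kD] _ [f [f_inj fG]] small.
pose phi (s : seq 'I_D) := f (insub_bseq h.+1 s).
have insubE (s : seq 'I_D) : (size s <= h.+1)%N -> insub_bseq h.+1 s = s :> seq _.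
  by move=> sh; rewrite /insub_bseq insubdK.
have phi_inj : {in [pred s | (size s <= h.+1)%N] &, injective phi}.
  move=> s s'; rewrite !inE => sh sh' /f_inj/(congr1 val) /=.
  by rewrite !insubE.
pose A (p : h.-bseq 'I_D * {set 'I_D}) :=
  [set [set phi p.1; phi (rcons p.1 i)] | i in p.2].
have A_card p : #|A p| = #|p.2|.
  apply: card_in_imset => i j _ _ /eq_set2r/phi_inj.
  have p1h : (size p.1 < h.+1)%N by rewrite ltnS size_bseq.
  by rewrite !inE !size_rcons => /(_ p1h p1h)/rcons_inj[].
pose P := [pred p : h.-bseq 'I_D * {set 'I_D} | #|p.2| == (D - k).+1].
have A_sub p : P p -> A p \subset G.
  move=> _; apply/fintype.subsetP => e /imsetP[i _ ->].
  have := fG [set insub_bseq _ p.1; insub_bseq _ (rcons p.1 i)].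
  rewrite imsetU1 imset_set1; apply; rewrite inE; apply/existsP; exists (insub_bseq _ p.1).
  apply/existsP; exists (insub_bseq _ (rcons p.1 i)); apply/existsP; exists i.
  by rewrite !insubE ?size_rcons ?ltnS ?size_bseq// ?eqxx// leqW// size_bseq.
apply: client_wins_mono (client_wins_transversal (R := R) set0 A_sub _); last first.
  rewrite (eq_bigr (fun=> (q%:R / q.+1%:R) ^+ (D - k).+1)) => [|p /eqP pP];
    last by rewrite A_card pP.
  rewrite sumr_const; apply: le_lt_trans small; rewrite -[leLHS]mulr_natl.
  rewrite ler_wpM2r ?exprn_ge0 ?divr_ge0// ler_nat eq_leq//.
  rewrite -big_distrl /=.
  have := card_bseq h 'I_D; rewrite card_ord => <-.
  have <- : #|[set B : {set 'I_D} | #|B| == (D - k).+1]| = 'C(D, (D - k).+1).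
    by rewrite card_draws card_ord.
  rewrite -cardsT -cardsX; apply: eq_card => p; by rewrite !inE.
move=> C hit; apply: (contains_copy_in_kary (leq_trans k0 kD) phi_inj) => u uh.
(* If Client has fewer than [k] child edges at [u], at least [D - k + 1] of them are not his, and
   any [D - k + 1] of those form a set he failed to hit. *)
rewrite leqNgt; apply/negP => few.
set S := [set i | _] in few.
have : ((D - k).+1 <= #|~: S|)%N.
  by have := cardsC S; rewrite card_ord; lia.
move=> /exists_subset_card[B BS /eqP cB].
have /negP := hit (insub_bseq h u, B) cB; apply.
have uE : insub_bseq h u = u :> seq _ by rewrite /insub_bseq insubdK.
apply/pred0P => e /=; apply/negP => /andP[/imsetP[i iB ->] /=].
rewrite uE => eC; have := fintype.subsetP BS _ iB; by rewrite !inE eC.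
Qed.

(** * Numerical estimates for the initial danger *)

Lemma sum_expn_le (D n : nat) : (1 < D)%N -> (\sum_(i < n) D ^ i <= D ^ n)%N.
Proof.
move=> D1; elim: n => [|n IH]; first by rewrite big_ord0.
rewrite big_ord_recr /= expnS; apply: (@leq_trans (2 * D ^ n)); last by rewrite leq_mul.
by rewrite mul2n -addnn leq_add2r.
Qed.

Lemma bin_le_expn (n m : nat) : ('C(n, m) <= n ^ m)%N.
Proof.
apply: (@leq_trans (n ^_ m)); first by rewrite -bin_ffact leq_pmulr// fact_gt0.
elim: m n => [|m IH] n; first by rewrite ffactn0.
rewrite ffactnS expnS leq_mul// (leq_trans (IH _))//.
by case: m {IH} => // m; rewrite leq_exp2r// leq_pred.
Qed.

Section Numerics.
Variable R : realType.

Lemma expR_3half_ge : 42 / 10 <= expR (3 / 2 : R).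
Proof.
have -> : 3 / 2 = 1 / 16 * 24 :> R by lra.
rewrite expRM_natr; apply: (@le_trans _ _ ((1 + 1 / 16) ^+ 24)); first by lra.
by rewrite lerXn2r ?nnegrE ?expR_ge0 ?expR_ge1Dx//; lra.
Qed.

(** This is the tangent line of [ln] at [expR (3 / 2)], with its slope rounded up to [5 / 21]. It
    keeps [4 * (5 / 21)] below [1], as the final estimate of [board_condition] requires. *)
Lemma ln_le_affine (x : R) : 0 < x -> ln x <= x * (5 / 21) + 1 / 2.
Proof.
move=> x0; have := expR_ge1Dx (ln x - 3 / 2).
rewrite expRD expRN lnK ?posrE// => h.
have -> : 5 / 21 = (42 / 10)^-1 :> R by field.
suff : x / expR (3 / 2) <= x / (42 / 10) by lra.
by rewrite ler_pM2l// lef_pV2 ?posrE ?expR_gt0// expR_3half_ge.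
Qed.

(** With [k = x + 1], at most [2 * N ^ (4 x)] sets have to be hit, each of weight at most
    [expR (- (D - x) / (q + 1))], where [D / (q + 1) = k N]. As [2 <= expR 1], it is enough that [1
    + 4 x ln N - (x + 1) N + x / (q + 1) < 0]. *)
Lemma board_condition (k q : nat) (D := ((k * q.+1) ^ 2)%N) :
  (0 < k)%N -> (0 < q)%N ->
  (\sum_(i < k) D ^ i * 'C(D, (D - k).+1))%:R
    * (q%:R / q.+1%:R) ^+ (D - k).+1 < 1 :> R.
Proof.
case: k @D => // x D _ q0; set N := (x.+1 * q.+1)%N in D *.
have N1 : (1 < N)%N by rewrite /N; nia.
have xD : (x < D)%N by rewrite /D /N; nia.
have N0 : 0 < N%:R :> R by rewrite ltr0n ltnW.
have D1 : (1 < D)%N by rewrite /D; nia.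
have Q0 : 0 < q.+1%:R :> R by rewrite ltr0n.
rewrite subnS prednK ?subn_gt0// bin_sub; last exact: ltnW.
have cnt : (\sum_(i < x.+1) D ^ i * 'C(D, x) <= 2 * (D ^ x * D ^ x))%N.
  rewrite -big_distrl /= mulnA leq_mul ?bin_le_expn// big_ord_recr /=.
  by rewrite mul2n -addnn leq_add2r sum_expn_le.
have rle : q%:R / q.+1%:R <= expR (- q.+1%:R^-1) :> R.
  apply: le_trans (expR_ge1Dx _).
  by rewrite -[q%:R](addrK 1) natr1 mulrBl divff ?gt_eqF// mul1r.
apply: (@le_lt_trans _ _ (2 * (D ^ x * D ^ x)%:R * expR (- q.+1%:R^-1) ^+ (D - x))).
  apply: ler_pM => //.
    by rewrite -(natrM _ 2) ler_nat.
  by rewrite lerXn2r ?nnegrE ?divr_ge0 ?expR_ge0.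
have -> : (D ^ x * D ^ x)%:R = expR ((4 * x)%:R * ln N%:R) :> R.
  rewrite mulrC expRM_natr lnK ?posrE// -natrX /D -!expnM -expnD; congr (_ ^ _)%:R.
  by lia.
rewrite -expRM_natr.
have two : 2 <= expR 1 :> R by have := expR_ge1Dx (1 : R); lra.
rewrite -[ltRHS]expR0 -mulrA -expRD.
apply: (@le_lt_trans _ _ (expR 1 * expR ((4 * x)%:R * ln N%:R + - q.+1%:R^-1 * (D - x)%:R))).
  by rewrite ler_wpM2r ?expR_ge0.
rewrite -expRD ltr_expR.
rewrite natrB 1?ltnW// natrM.
have -> : - q.+1%:R^-1 * (D%:R - x%:R) = - (x.+1%:R * N%:R) + x%:R / q.+1%:R :> R.
  by rewrite /D natrX {2}/N natrM -natr1; field; rewrite natr1 gt_eqF.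
have lnN := ln_le_affine N0.
have x0 : 0 <= x%:R :> R by [].
have xQ : x%:R / q.+1%:R <= x%:R / 2 :> R.
  by rewrite ler_wpM2l// lef_pV2 ?posrE// ler_nat.
have Nx : 2 * (x%:R + 1) <= N%:R :> R.
  by rewrite natr1 -natrM ler_nat /N; nia.
have arith (a b c d : R) : 2 * (d + 1) <= c -> b <= c * (5 / 21) + 1 / 2 ->
    a <= d / 2 -> 0 <= d -> 1 + (4 * d * b + (- ((d + 1) * c) + a)) < 0.
  move=> dc bc ad d0; have := ler_wpM2l d0 bc; have := ler_wpM2l d0 dc.
  (* Eliminating [a], [b] and [c] leaves the bound [- 1 + 17 d / 42 - 2 d ^ 2 / 21], whose maximum,
     at [d = 17 / 8], is negative. *)
  by have := sqr_ge0 (d - 17 / 8); rewrite expr2 => *; lra.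
by rewrite -[x.+1%:R]natr1 arith.
Qed.

End Numerics.

(** * The second moment method for random subsets *)

Section SecondMoment.
Variable R : realFieldType.

(** Chebyshev's inequality for the finite distribution [w]: where [X] vanishes, [(X - mu) ^ 2]
    equals [mu ^ 2]. Here [var] is any upper bound for the variance. *)
Lemma second_moment (I : finType) (P : pred I) (w X : I -> R) (mu var : R) :
  (forall i, P i -> 0 <= w i) -> \sum_(i | P i) w i = 1 -> 0 < mu ->
  \sum_(i | P i) w i * X i = mu ->
  \sum_(i | P i) w i * X i ^+ 2 <= mu ^+ 2 + var ->
  1 - var / mu ^+ 2 <= \sum_(i | P i && (X i != 0)) w i.
Proof.
move=> w0 w1 mu0 EX EX2.
rewrite -w1 (bigID (fun i => X i != 0)) /= lerBlDr lerD2l.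
rewrite ler_pdivlMr ?exprn_gt0// mulr_suml.
have dev : \sum_(i | P i) w i * (X i - mu) ^+ 2 <= var.
  rewrite (eq_bigr (fun i => w i * X i ^+ 2 + (- (2 * mu) * (w i * X i)
    + mu ^+ 2 * w i))) => [|i _]; last by ring.
  rewrite !big_split /= -!mulr_sumr EX w1; lra.
apply: le_trans dev; rewrite [leRHS](bigID (fun i => X i != 0)) /= -[leLHS]add0r.
apply: lerD; first by apply: sumr_ge0 => i /andP[Pi _]; rewrite mulr_ge0 ?sqr_ge0 ?w0.
by apply: ler_sum => i /andP[_]; rewrite negbK => /eqP->; rewrite sub0r sqrrN.
Qed.

Variables (T : finType) (K : {set T}) (p : R).

(** For [G] inside [K], the probability that a random subset of [K] is [G]; with
    [K = complete_graph 'I_n] it is the weight summed in [Gnp_prob]. *)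
Definition subset_weight (G : {set T}) : R :=
  \prod_(e in K) (if e \in G then p else 1 - p).

Lemma subset_weight_ge0 (G : {set T}) : 0 <= p <= 1 -> 0 <= subset_weight G.
Proof. by move=> p01; apply: prodr_ge0 => e _; case: ifP => _; lra. Qed.

Lemma sum_subset_weight (A : {set T}) : A \subset K ->
  \sum_(G : {set T} | (G \subset K) && (A \subset G)) subset_weight G = p ^+ #|A|.
Proof.
move=> AK.
(* [F] and [F'] weigh having and not having [e] in [G]. Their zeros kill the subsets not lying
   between [A] and [K], so the sum factors over [e], with factor [p] on [A] and [1] elsewhere. *)
pose F e : R := if e \in K then p else 0.
pose F' e : R := if e \in K then (if e \in A then 0 else 1 - p) else 1.
transitivity (\prod_e (F e + F' e)).
  rewrite bigA_distr [RHS](bigID (fun G : {set T} => (G \subset K) && (A \subset G))) /=.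
  rewrite [X in _ = _ + X]big1 ?addr0 => [|G nG].
    apply: eq_big => [G|G /andP[GK AG]]; first by [].
    rewrite /subset_weight big_mkcond /=; apply: eq_bigr => e _.
    rewrite /F /F'; case: ifP => eK; last first.
      by case: ifP => // eG; rewrite (fintype.subsetP GK _ eG) in eK.
    by case: ifP => // eG; case: ifP => // eA; rewrite (fintype.subsetP AG _ eA) in eG.
  have [|/fintype.subsetPn[e eG eK]] := boolP (G \subset K); last first.
    by rewrite (bigD1 e)//= eG /F (negbTE eK) mul0r.
  move=> GK; rewrite GK /= in nG; have /fintype.subsetPn[e eA eG] := nG.
  by rewrite (bigD1 e)//= (negbTE eG) /F' (fintype.subsetP AK _ eA) eA mul0r.
rewrite -prodr_const [RHS]big_mkcond /=; apply: eq_bigr => e _.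
rewrite /F /F'; case: ifP => eK; case: ifP => eA; rewrite ?addr0 ?add0r//.
  by rewrite addrC subrK.
by rewrite (fintype.subsetP AK _ eA) in eK.
Qed.

Variables (J : finType) (A : J -> {set T}) (a : nat).
Hypothesis A_sub : forall f, A f \subset K.
Hypothesis A_card : forall f, #|A f| = a.

Let X (G : {set T}) : R := \sum_f (A f \subset G)%:R.

Lemma subset_first_moment :
  \sum_(G : {set T} | G \subset K) subset_weight G * X G = #|J|%:R * p ^+ a.
Proof.
under eq_bigr => G _ do rewrite mulr_sumr.
rewrite exchange_big /= mulr_natl -sumr_const; apply: eq_bigr => f _.
rewrite -(A_card f) -sum_subset_weight// [RHS]big_mkcondr /=.
by apply: eq_bigr => G _; case: ifP => _; rewrite ?mulr1 ?mulr0.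
Qed.

Lemma subset_second_moment :
  \sum_(G : {set T} | G \subset K) subset_weight G * X G ^+ 2
    = \sum_f \sum_g p ^+ #|A f :|: A g|.
Proof.
under eq_bigr => G _ do rewrite expr2 mulr_suml mulr_sumr.
rewrite exchange_big /=; apply: eq_bigr => f _.
under eq_bigr => G _ do rewrite mulr_sumr mulr_sumr.
rewrite exchange_big /=; apply: eq_bigr => g _.
rewrite -sum_subset_weight ?subUset ?A_sub// [RHS]big_mkcondr /=.
apply: eq_bigr => G _; rewrite subUset.
by do 2!case: (_ \subset _); rewrite /= ?mulr1 ?mulr0 ?mul0r ?mulr0.
Qed.

Lemma subset_second_moment_method (var : R) :
  0 <= p <= 1 -> 0 < #|J|%:R * p ^+ a ->
  \sum_f \sum_g p ^+ #|A f :|: A g| <= (#|J|%:R * p ^+ a) ^+ 2 + var ->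
  1 - var / (#|J|%:R * p ^+ a) ^+ 2
    <= \sum_(G : {set T} | (G \subset K) && [exists f, A f \subset G])
         subset_weight G.
Proof.
move=> p01 mu0 EX2.
rewrite (eq_bigl (fun G : {set T} => (G \subset K) && (X G != 0))) => [|G].
  apply: second_moment mu0 subset_first_moment _ => //.
  - by move=> G _; apply: subset_weight_ge0.
  - rewrite -(expr0 p) -(@cards0 T) -sum_subset_weight ?sub0set//.
    by apply: eq_bigl => G; rewrite sub0set andbT.
  - by rewrite subset_second_moment.
congr (_ && _); rewrite /X psumr_neq0 => [|f _]; last exact: ler0n.
apply/existsP/hasP => [[f fG]|[f _ /=]].
  by exists f; rewrite ?mem_index_enum//= fG ltr01.
by rewrite ltr0n lt0b; exists f.
Qed.

End SecondMoment.

(** * Overlaps of two copies of a tree *)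

Lemma eq_set2 (T : finType) (a b c d : T) :
  [set a; b] = [set c; d] -> (a = c /\ b = d) \/ (a = d /\ b = c).
Proof.
move=> E.
have : a \in [set c; d] by rewrite -E set21.
rewrite !inE => /orP[] /eqP ac; subst a; [left|right]; split=> //.
  exact: eq_set2r E.
by apply: (@eq_set2r _ d); rewrite E setUC.
Qed.

Section TreeEmbedding.
Variables (W V : finType) (root : W) (par : W -> W) (depth : W -> nat) (m : nat).
Hypothesis par_depth : forall u, u != root -> (depth (par u) < depth u)%N.
Variable iota : W * 'I_m -> V.
Hypothesis iota_inj : injective iota.

(** Each tree vertex has its own part of [V], the image of its slice of [W * 'I_m]. Every [f] thus
    yields an injective copy, and two copies meet in a vertex only where their maps agree. *)
Definition place (f : {ffun W -> 'I_m}) (u : W) : V := iota (u, f u).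

Definition tree_edges (f : {ffun W -> 'I_m}) : {set {set V}} :=
  [set [set place f u; place f (par u)] | u in ~: [set root]].

Definition agreement (f g : {ffun W -> 'I_m}) : {set W} := [set u | f u == g u].

Lemma place_inj (f : {ffun W -> 'I_m}) : injective (place f).
Proof. by move=> u v /iota_inj[]. Qed.

Lemma tree_edges_sub (f : {ffun W -> 'I_m}) : tree_edges f \subset complete_graph V.
Proof.
apply/fintype.subsetP => e /imsetP[u]; rewrite !inE => ur ->.
rewrite cards2 (inj_eq (@place_inj f)) eq_sym.
by have [pu|//] := eqVneq (par u) u; have := par_depth ur; rewrite pu ltnn.
Qed.

(* The parent function is well founded, so an edge determines which of its two
   ends is the child. *)
Lemma tree_edges_eq (f g : {ffun W -> 'I_m}) (u v : W) :
  u != root -> v != root ->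
  [set place f u; place f (par u)] = [set place g v; place g (par v)] ->
  [/\ u = v, f u = g u & f (par u) = g (par u)].
Proof.
move=> ur vr /eq_set2[] [/iota_inj[uv fu] /iota_inj[pu fpu]].
  by subst v; split; rewrite ?fpu// pu.
by have := par_depth ur; have := par_depth vr; rewrite -uv pu; case: ltngtP.
Qed.

Lemma card_tree_edges (f : {ffun W -> 'I_m}) : #|tree_edges f| = #|W|.-1.
Proof.
rewrite card_in_imset => [|u v]; first by rewrite cardsC1.
by rewrite !inE => ur vr /tree_edges_eq[].
Qed.

(** A shared edge joins a vertex of [J] to its parent in [J], hence is determined by its child. A
    vertex of least depth in [J] is not such a child, which saves one. *)
Lemma card_tree_edgesI (f g : {ffun W -> 'I_m}) :
  (#|tree_edges f :&: tree_edges g| <= #|agreement f g|.-1)%N.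
Proof.
set J := agreement f g.
pose S := [set u in J | (u != root) && (par u \in J)].
have sub : tree_edges f :&: tree_edges g
    \subset [set [set place f u; place f (par u)] | u in S].
  apply/fintype.subsetP => e /setIP[/imsetP[u ur ->] /imsetP[v vr uv]].
  rewrite !inE in ur vr; have [_ fu fpu] := tree_edges_eq ur vr uv.
  by apply/imsetP; exists u => //; rewrite !inE ur fu fpu !eqxx.
apply: (leq_trans (subset_leq_card sub)); apply: (leq_trans (leq_imset_card _ _)).
have [u0 u0J|J0] := pickP (mem J); last first.
  by rewrite eq_card0// => u; rewrite !inE; have := J0 u; rewrite /= !inE => ->.
case: (@arg_minnP _ u0 (mem J) depth u0J) => u uJ umin.
have {}uJ : u \in J := uJ.
have uS : u \notin S.
  rewrite inE negb_and; apply/orP; right; apply/negP => /andP[ur puJ].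
  by have := umin _ puJ; rewrite leqNgt par_depth.
apply: (@leq_trans #|J :\ u|).
  apply/subset_leq_card/fintype.subsetP => v vS; rewrite !inE.
  have vu : v != u by apply: contraNneq uS => <-.
  by rewrite vu; move: vS; rewrite !inE => /andP[].
by rewrite (cardsD1 u J) uJ.
Qed.

Lemma card_agreement_sup (J : {set W}) (f : {ffun W -> 'I_m}) :
  #|[set g | J \subset agreement f g]| = (m ^ (#|W| - #|J|))%N.
Proof.
have -> : #|[set g | J \subset agreement f g]|
    = #|family (fun u => if u \in J then pred1 (f u) else predT)|.
  apply: eq_card => g; rewrite !inE; apply/fintype.subsetP/familyP => H u.
    by case: ifP => // /H; rewrite !inE eq_sym.
  by move=> uJ; have := H u; rewrite !inE [u \in J]uJ /= inE eq_sym.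
rewrite card_family foldrE big_map big_enum /=.
rewrite (bigID [in J]) /= big1 => [|u uJ]; last by rewrite uJ card1.
rewrite mul1n (eq_bigr (fun=> m)) => [|u /negbTE->]; last by rewrite card_ord.
by rewrite prod_nat_const -(cardC J) addKn; congr (_ ^ _)%N; apply: eq_card.
Qed.

Variables (R : realFieldType) (p : R).
Let v := #|W|.

(** Two copies with nonempty agreement set [J] cover at least [(v - 1) + (v - #|J|)] edges. For
    fixed [f] and [J], the [m ^ (v - #|J|)] maps [g] agreeing with [f] on [J] are compensated by
    [m p <= 1]; at most [2 ^ v] sets [J] and [m ^ v] maps [f] remain. *)
Lemma tree_overlap_sum :
  0 <= p <= 1 -> m%:R * p <= 1 ->
  \sum_f \sum_g p ^+ #|tree_edges f :|: tree_edges g|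
    <= ((m ^ v)%:R * p ^+ v.-1) ^+ 2 + 2 ^+ v * ((m ^ v)%:R * p ^+ v.-1).
Proof.
move=> /andP[p0 p1] mp; set mu := _ * _.
have mu0 : 0 <= mu by rewrite mulr_ge0 ?exprn_ge0.
(* Summing over all nonempty [J] inside the agreement set, not just the set itself, only weakens the
   bound and makes the later count of [g] for given [J] exact. *)
have bnd f g : p ^+ #|tree_edges f :|: tree_edges g|
    <= p ^+ v.-1 ^+ 2 + \sum_(J : {set W} | (J != set0) && (J \subset agreement f g))
         p ^+ v.-1 * p ^+ (v - #|J|).
  rewrite cardsU !card_tree_edges -/v.
  have Ile := card_tree_edgesI f g.
  have sum0 : 0 <= \sum_(J : {set W} | (J != set0) && (J \subset agreement f g))
         p ^+ v.-1 * p ^+ (v - #|J|).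
    by apply: sumr_ge0 => J _; rewrite mulr_ge0 ?exprn_ge0.
  have [Z|nZ] := eqVneq (agreement f g) set0.
    have -> : #|tree_edges f :&: tree_edges g| = 0%N.
      by apply/eqP; rewrite -leqn0; move: Ile; rewrite Z cards0.
    by rewrite subn0 -exprM muln2 -addnn lerDl.
  rewrite (bigD1 (agreement f g)) /=; last by rewrite nZ fintype.subxx.
  have Jv : (#|agreement f g| <= v)%N by apply: max_card.
  have J1 : (0 < #|agreement f g|)%N by rewrite card_gt0.
  rewrite -exprD -exprM.
  rewrite addrCA -[leLHS]addr0; apply: lerD.
    apply: ler_wiXn2l => //; move: Jv J1 Ile.
    by move: #|_ :&: _| #|agreement f g| (v) => a b c; clear; lia.
  rewrite addr_ge0 ?exprn_ge0//.
  by apply: sumr_ge0 => J _; rewrite mulr_ge0 ?exprn_ge0.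
apply: (@le_trans _ _ (\sum_(f : {ffun W -> 'I_m}) \sum_(g : {ffun W -> 'I_m})
   (p ^+ v.-1 ^+ 2 + \sum_(J : {set W} | (J != set0) && (J \subset agreement f g))
         p ^+ v.-1 * p ^+ (v - #|J|)))).
  by apply: ler_sum => f _; apply: ler_sum => g _; exact: bnd.
have cardF : #|{ffun W -> 'I_m}| = (m ^ v)%N by rewrite card_ffun card_ord.
have inner (f : {ffun W -> 'I_m}) : \sum_(g : {ffun W -> 'I_m})
   (p ^+ v.-1 ^+ 2 + \sum_(J : {set W} | (J != set0) && (J \subset agreement f g))
         p ^+ v.-1 * p ^+ (v - #|J|)) <= (m ^ v)%:R * p ^+ v.-1 ^+ 2 + 2 ^+ v * p ^+ v.-1.
  rewrite big_split /= sumr_const cardF -[X in X + _]mulr_natl lerD2l.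
  rewrite (exchange_big_dep (fun J => J != set0)) /=; last by move=> g J _ /andP[].
  apply: (@le_trans _ _ (\sum_(J : {set W}) p ^+ v.-1)); last first.
    by rewrite sumr_const -cardsT -powersetT card_powerset cardsT -natrX mulr_natl.
  rewrite [leRHS](bigID (fun J => J != set0)) /= -[leLHS]addr0 lerD//; last first.
    by apply: sumr_ge0 => J _; rewrite exprn_ge0.
  apply: ler_sum => J J0; rewrite sumr_const -[leLHS]mulr_natr.
  rewrite [X in _ * X%:R](_ : _ = m ^ (v - #|J|))%N; last first.
    by rewrite -(card_agreement_sup J f); apply: eq_card => g; rewrite !inE J0.
  rewrite -mulrA -[leRHS]mulr1 ler_wpM2l ?exprn_ge0//.
  by rewrite natrX -exprMn mulrC exprn_ile1// mulr_ge0.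
apply: (le_trans (ler_sum _ (fun f _ => inner f))).
rewrite [leLHS](_ : _ = mu ^+ 2 + 2 ^+ v * mu)// sumr_const cardF.
by rewrite -[LHS]mulr_natl /mu; ring.
Qed.

End TreeEmbedding.

(** * The random graph *)

Lemma le_Gnp_prob (R : realType) (n : nat) (p : R) (A B : {set {set 'I_n}} -> Prop) :
  0 <= p <= 1 -> (forall G, A G -> B G) -> Gnp_prob p A <= Gnp_prob p B.
Proof.
move=> p01 AB; rewrite /Gnp_prob [leLHS]big_mkcondr [leRHS]big_mkcondr /=.
apply: ler_sum => G _; case: asboolP => [/AB BG|_]; first by rewrite asboolT.
by case: asboolP => // _; exact: subset_weight_ge0.
Qed.

Lemma Gnp_prob_le1 (R : realType) (n : nat) (p : R) (A : {set {set 'I_n}} -> Prop) :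
  0 <= p <= 1 -> Gnp_prob p A <= 1.
Proof.
move=> p01; apply: (@le_trans _ _ (Gnp_prob p (fun=> True))); first exact: le_Gnp_prob.
(* Total mass [1] is [sum_subset_weight] applied to the empty set of edges. *)
rewrite -(expr0 p) -(@cards0 {set 'I_n}).
rewrite -(@sum_subset_weight _ _ (complete_graph 'I_n)) ?sub0set// le_eqVlt.
apply/orP; left; apply/eqP; apply: eq_bigl => G.
by rewrite asboolT// sub0set.
Qed.

(** The second moment method with variance bound [2 ^ #|W| * mu]. The parts are cut out of ['I_n] by
    numbering [W * 'I_m], which is where [#|W| * m <= n] enters. *)
Lemma Gnp_contains_tree (R : realType) (W : finType) (root : W) (par : W -> W)
    (depth : W -> nat) (n m : nat) (p : R) (mu := (m ^ #|W|)%:R * p ^+ #|W|.-1) :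
  (forall u, u != root -> (depth (par u) < depth u)%N) ->
  (#|W| * m <= n)%N -> 0 <= p <= 1 -> m%:R * p <= 1 -> 0 < mu ->
  1 - 2 ^+ #|W| / mu <= Gnp_prob p (fun G : {set {set 'I_n}} =>
    exists2 f : W -> 'I_n, injective f &
      forall u, u != root -> [set f u; f (par u)] \in G).
Proof.
move=> par_depth Wm p01 mp mu0.
have cardWm : (#|{: W * 'I_m}| <= n)%N by rewrite card_prod card_ord.
pose iota (x : W * 'I_m) := widen_ord cardWm (enum_rank x).
have iota_inj : injective iota.
  by move=> x y /(congr1 val) /= /val_inj/enum_rank_inj.
have cardF : #|{ffun W -> 'I_m}| = (m ^ #|W|)%N by rewrite card_ffun card_ord.
have := @subset_second_moment_method R _ (complete_graph 'I_n) p _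
  (tree_edges root par iota) #|W|.-1 (tree_edges_sub par_depth iota_inj)
  (card_tree_edges par_depth iota_inj) (2 ^+ #|W| * mu) p01.
rewrite cardF => /(_ mu0 (tree_overlap_sum par_depth iota_inj p01 mp)).
rewrite -/mu expr2 invfM mulrA mulfK ?gt_eqF// => le; apply: (le_trans le).
have -> : \sum_(G : {set {set 'I_n}} | (G \subset complete_graph 'I_n)
      && [exists f, tree_edges root par iota f \subset G])
    subset_weight (complete_graph 'I_n) p G
  = Gnp_prob p (fun G => [exists f, tree_edges root par iota f \subset G]).
  by apply: eq_bigl => G; rewrite asboolb.
apply: le_Gnp_prob p01 _ => G /existsP[f fG].
exists (place iota f); first exact: place_inj.
move=> u ur; apply: (fintype.subsetP fG); apply/imsetP; exists u => //.
by rewrite !inE.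
Qed.

Lemma Gnp_contains_karytree (R : realType) (D h n m : nat) (p : R)
    (v := (\sum_(i < h.+1) D ^ i)%N) (mu := (m ^ v)%:R * p ^+ v.-1) :
  (v * m <= n)%N -> 0 <= p <= 1 -> m%:R * p <= 1 -> 0 < mu ->
  1 - 2 ^+ v / mu <=
    Gnp_prob p (fun G : {set {set 'I_n}} => contains_copy G (karytree D h)).
Proof.
have vE : #|{: h.-bseq 'I_D}| = v by rewrite card_bseq card_ord.
move=> vm p01 mp mu0.
(* The parent deletes the last letter; the root becomes its own parent, which [par_depth]
   exempts. *)
pose par (u : h.-bseq 'I_D) := insub_bseq h (take (size u).-1 u).
have parE u : par u = take (size u).-1 u :> seq _.
  rewrite /par /insub_bseq insubdK// unfold_in size_take.
  by case: ifP => _; have := size_bseq u; lia.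
have par_depth (u : h.-bseq 'I_D) : u != [bseq] -> (size (par u) < size u)%N.
  by rewrite parE -val_eqE /= -size_eq0 size_take; case: (size u) => //= s _; rewrite ltnSn.
have := @Gnp_contains_tree R _ _ par (fun u => size u) n m p par_depth.
rewrite vE => /(_ vm p01 mp mu0) le; apply: (le_trans le).
apply: le_Gnp_prob p01 _ => G [f f_inj fG]; exists f; split=> // e.
rewrite inE => /existsP[u /existsP[w /existsP[i /andP[/eqP wE /eqP ->]]]].
rewrite imsetU1 imset_set1 setUC.
have -> : u = par w.
  by apply: val_inj; rewrite /= parE wE size_rcons -cats1 take_size_cat.
by apply: fG; rewrite -val_eqE /= wE; case: (bseqval u).
Qed.

(** * Asymptotics as the number of vertices grows *)

Lemma cvg_powR_pinfty (R : realType) (d : R) : 0 < d ->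
  ((n%:R : R) `^ d @[n --> \oo] --> +oo)%classic.
Proof.
move=> d0; apply/cvgryPge => A.
near=> n.
have An : Num.max 1 A `^ d^-1 <= n%:R by near: n; exact: nbhs_infty_ger.
have A0 : 0 <= Num.max 1 A by rewrite le_max ler01.
apply: (@le_trans _ _ (Num.max 1 A)); first by rewrite le_max lexx orbT.
have -> : Num.max 1 A = (Num.max 1 A `^ d^-1) `^ d.
  by rewrite -powRrM mulVf ?lt0r_neq0// powRr1.
by apply: (ge0_ler_powR (ltW d0)); rewrite ?nnegrE ?powR_ge0.
Unshelve. all: by end_near. Qed.

Lemma powR_negative_bounds (R : realType) (n : nat) (a : R) :
  (0 < n)%N -> 0 <= a -> 0 <= (n%:R : R) `^ (- 1 - a) <= 1 /\
    n%:R * (n%:R : R) `^ (- 1 - a) <= 1.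
Proof.
move=> n0 a0; have n1 : 1 <= n%:R :> R by rewrite ler1n.
have le1 (b : R) : 0 <= b -> n%:R `^ (- b) <= 1 :> R.
  by move=> b0; rewrite powRN invf_le1 ?powR_gt0 ?ltr0n// -[leLHS](powRr0 n%:R) ler_powR.
split; first by rewrite powR_ge0 -opprD le1// addr_ge0.
have := le1 a a0; rewrite powRB; last by rewrite pnatr_eq0 -lt0n n0 implybT.
by rewrite powR_inv1// mulrA divff ?pnatr_eq0 -?lt0n// mul1r -powRN.
Qed.

(** With [m = n %/ v], one has [n <= 2 v m] once [v <= n], so [mu >= n ^ d / (2 v) ^ v] for [d = v -
    (v - 1) (1 + a) = 1 - (v - 1) a > 0]. The failure probability is then at most [c / n ^ d]. *)
Lemma Gnp_contains_karytree_whp (R : realType) (D h : nat) (a : R) :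
  0 <= a -> (\sum_(i < h.+1) D ^ i)%N.-1%:R * a < 1 ->
  (Gnp_prob ((n%:R : R) `^ (- 1 - a))
    (fun G : {set {set 'I_n}} => contains_copy G (karytree D h))
   @[n --> \oo] --> (1 : R))%classic.
Proof.
set v := (\sum_(_ < _) _)%N => a0 va.
pose d : R := 1 - v.-1%:R * a.
have d0 : 0 < d by rewrite subr_gt0.
have v0 : (0 < v)%N by rewrite /v big_ord_recl expn0.
pose c : R := 2 ^+ v * (2 * v)%:R ^+ v.
apply: (@squeeze_cvgr _ _ _ _ (fun n : nat => 1 - c * (n%:R `^ d)^-1) (fun=> 1)).
- near=> n.
  have nv : (v <= n)%N by near: n; exact: nbhs_infty_ge.
  have n0 : (0 < n)%N by apply: leq_trans nv.
  have nR0 : 0 < n%:R :> R by rewrite ltr0n.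
  have [p01 np] := powR_negative_bounds n0 a0.
  rewrite Gnp_prob_le1// andbT.
  set p := _ `^ _ in p01 np *.
  have m0 : (0 < n %/ v)%N by rewrite divn_gt0.
  have p0 : 0 < p by rewrite powR_gt0.
  have mu0 : 0 < ((n %/ v) ^ v)%:R * p ^+ v.-1.
    by rewrite mulr_gt0 ?exprn_gt0// ltr0n expn_gt0 m0.
  have mp : (n %/ v)%:R * p <= 1.
    by apply: le_trans np; rewrite ler_wpM2r ?(ltW p0)// ler_nat leq_div.
  have vm : (v * (n %/ v) <= n)%N by rewrite mulnC leq_divM.
  apply: (le_trans _ (Gnp_contains_karytree vm p01 mp mu0)).
  rewrite lerD2l lerN2 -/v /c -mulrA ler_wpM2l ?exprn_ge0//.
  rewrite -[leLHS]mul1r ler_pdivrMr// mulrAC ler_pdivlMr ?powR_gt0// mul1r.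
  have -> : (n%:R : R) `^ d = n%:R ^+ v * p ^+ v.-1.
    rewrite -!powR_mulrn ?powR_ge0// /p -powRrM -powRD; last first.
      by rewrite pnatr_eq0 -lt0n n0 implybT.
    congr (_ `^ _); rewrite -[in v%:R](prednK v0) -natr1 /d; ring.
  rewrite mulrA ler_wpM2r ?exprn_ge0 ?powR_ge0//.
  rewrite natrX -exprMn lerXn2r ?nnegrE// -natrM ler_nat.
  have := ltn_ceil n v0; nia.
- rewrite -[X in (_ --> X)%classic]subr0; apply: cvgB; first exact: cvg_cst.
  rewrite -(mulr0 c); apply: cvgMl_tmp.
  apply/gtr0_cvgV0; last exact: cvg_powR_pinfty.
  near=> n; rewrite powR_gt0// ltr0n; near: n; exact: nbhs_infty_gt.
- exact: cvg_cst.
Unshelve. all: by end_near. Qed.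

Local Open Scope classical_set_scope.

Theorem proposition1p9 (R : realType) (k q : nat)
    (hk : (0 < k)%N) (hq : (0 < q)%N) :
  (fun n : nat =>
     Gnp_prob
       ((n%:R : R) `^ (- 1 - ((k * (q + 1))%:R : R) ^- (2 * (k + 1))))
       (fun G : {set {set 'I_n}} => client_wins_CW G (karytree k k) q))
  @ \oo --> (1 : R).
Proof.
rewrite !addn1; set a := _ ^- _; set D := ((k * q.+1) ^ 2)%N.
have N1 : (1 < k * q.+1)%N by nia.
have D1 : (1 < D)%N by rewrite /D; nia.
have a0 : 0 < a by rewrite invr_gt0 exprn_gt0// ltr0n ltnW.
(* [1 / a] is [D ^ (k + 1)], which bounds the number of vertices of the tree; the predecessor makes
   the inequality strict. *)
have va : (\sum_(i < k.+1) D ^ i)%N.-1%:R * a < 1.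
  rewrite ltr_pdivrMr ?mul1r ?exprn_gt0 ?ltr0n 1?ltnW// -natrX ltr_nat.
  rewrite expnM -/D.
  case: (\sum_(i < k.+1) D ^ i)%N (sum_expn_le k.+1 D1) => //= _.
  by rewrite expn_gt0 (ltnW D1).
apply: (@squeeze_cvgr _ _ _ _ (fun n => Gnp_prob ((n%:R : R) `^ (- 1 - a))
    (fun G : {set {set 'I_n}} => contains_copy G (karytree D k))) (fun=> 1)); last 2 first.
- exact: Gnp_contains_karytree_whp (ltW a0) va.
- exact: cvg_cst.
near=> n.
have n0 : (0 < n)%N by near: n; exact: nbhs_infty_gt.
have [p01 _] := powR_negative_bounds n0 (ltW a0).
rewrite Gnp_prob_le1// andbT; apply: le_Gnp_prob => // G.
move=> copy; apply: (client_wins_kary _ hk copy (board_condition R hk hq)).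
by rewrite hk /D; nia.
Unshelve. all: by end_near. Qed.
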